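(* Fix $0<\delta<1$ and caps $\lambda_t\in[0,\bar D]$ with carry-safe caps $a_t=\min_{s=t,\ldots,T}\lambda_s$, $t\in[T]$, chosen as described in the context; let $q_t=p_t/(h_t+p_t)$, and condition on the complete boundary array. Let $$\mathcal J_t=\{j\in[N_t]:b_t^j\ge a_t\},\qquad m_t=|\mathcal J_t|\ge1,\qquad\widehat F_t^-(a_t)=\frac1{m_t}\sum_{j\in\mathcal J_t}\mathbf 1\{Z_t^j<a_t\}$$ (because $b_t^j\ge a_t$, the displayed indicator equals $\mathbf 1\{D_t^j<a_t\}$), and define $$r_t=\sqrt{\frac{\log(2T/\delta)}{2m_t}}.$$ With probability at least $1-\delta$, passing the test $\widehat F_t^-(a_t)-r_t>q_t$ in every period $t\in[T]$ implies the coverage condition $F_t^-(a_t)>q_t$ for all $t\in[T]$. Moreover, for margins $\gamma_t>0$, if $F_t^-(a_t)\ge q_t+\gamma_t$ and $m_t>2\gamma_t^{-2}\log(2T/\delta)$ for every $t\in[T]$, the test passes simultaneously in all periods with probability at least $1-\delta$.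
   Context: $[n]=\{1,\ldots,n\}$; $T$ is the number of periods; $h_t,p_t>0$ are known holding and shortage coefficients. Demands $D_t$, $t\in[T]$, are independent with laws $P_t$ supported on $[0,\bar D]$, $\bar D>0$, and $F_t^-(u)=\mathbb P(D_t<u)$. Offline data are sales logs $((Z_t^j,b_t^j):t\in[T],j\in[N_t])$ with known boundary $b_t^j\ge0$ and observed $Z_t^j=\min\{D_t^j,b_t^j\}$, where $D_t^j$ is a latent fitting demand. Conditional noninformative censoring is assumed: conditional on the complete boundary array $\mathcal B=(b_t^j)$, all latent $D_t^j$ are mutually independent and $D_t^j$ has law $P_t$; each boundary is fixed or determined before its own demand. The numbers $\lambda_t$ are chosen before observing fitting demands, or using only $\mathcal B$; an independent pilot is also allowed if, conditional on the pilot, design information, and complete boundaries, fitting demands remain independent with laws $P_t$. Logarithms are natural. *)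

(* Defs.v *)
From HB Require Import structures.
From mathcomp Require Import all_boot all_order all_algebra.
From mathcomp Require Import all_classical all_reals all_analysis.
From mathcomp Require Import measurable_realfun.

Set Implicit Arguments.
Unset Strict Implicit.
Unset Printing Implicit Defensive.

Import Order.TTheory GRing.Theory Num.Theory.
Import numFieldNormedType.Exports.

Local Open Scope classical_set_scope.
Local Open Scope ring_scope.
Local Open Scope charge_scope.

(* Analysis over an abstract [R : realType] (MathComp-Analysis).  Periods are
   indexed by ['I_T], i.e. by 0, ..., T - 1. *)

Section Conditioning.
Context d (Omega : measurableType d) (R : realType) (P : probability Omega R).

Definition sigma_measurable (G : set (set Omega)) (f : Omega -> R) : Prop :=
  forall Y : set R, measurable Y -> G (f @^-1` Y).

(* [f] is a version of the conditional probability P(A | G). *)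
Definition is_cond_prob (G : set (set Omega)) (A : set Omega)
    (f : Omega -> R) : Prop :=
  [/\ sigma_measurable G f,
      P.-integrable setT (EFin \o f) &
      forall E, G E -> (\int[P]_(w in E) (f w)%:E = P (A `&` E))%E].

(* The constant function [mu A] is a version of P(X \in A | G): given G, the
   (regular) conditional law of X is the nonrandom measure mu. *)
Definition cond_law (G : set (set Omega)) (X : {RV P >-> R})
    (mu : set R -> \bar R) : Prop :=
  forall A : set R, measurable A ->
    is_cond_prob G (X @^-1` A) (fun=> fine (mu A)).

Definition mutually_independent (I : finType) (X : I -> {RV P >-> R}) : Prop :=
  forall (J : {set I}) (A : I -> set R), (forall i, measurable (A i)) ->
    (P (\bigcap_(i in [set` J]) X i @^-1` A i)
     = \prod_(i in J) P (X i @^-1` A i))%E.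

(* The product rule for conditional probabilities, for any choice of versions
   of the factors. *)
Definition cond_mutually_independent (G : set (set Omega)) (I : finType)
    (X : I -> {RV P >-> R}) : Prop :=
  forall (J : {set I}) (A : I -> set R) (f : I -> Omega -> R),
    (forall i, measurable (A i)) ->
    (forall i, is_cond_prob G (X i @^-1` A i) (f i)) ->
    is_cond_prob G (\bigcap_(i in [set` J]) X i @^-1` A i)
      (fun w => \prod_(i in J) f i w).

(* P(A | G) >= c almost surely on the event H, for every version of P(A | G).
   [is_cond_prob_exists] below shows that versions exist. *)
Definition cond_prob_ge_on (G : set (set Omega)) (A : set Omega) (c : R)
    (H : set Omega) : Prop :=
  forall f, is_cond_prob G A f -> {ae P, forall w, H w -> c <= f w}.

Lemma is_cond_prob_exists (G : set (set Omega)) (A : set Omega) :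
  G `<=` measurable -> measurable A -> exists f, is_cond_prob <<s G >> A f.
Proof.
move=> Gm mA.
have sGm : <<s G >> `<=` (@measurable _ Omega).
  by apply: smallest_sub => //; exact: sigma_algebra_measurable.
pose T' : measurableType _ := g_sigma_algebraType G.
have mid : measurable_fun setT (idfun : Omega -> T').
  by move=> _ Y mY; rewrite setTI; exact: sGm.
pose idG : {mfun Omega >-> T'} := HB.pack (idfun : Omega -> T')
  (isMeasurableFun.Build _ _ _ _ _ mid).
have PAoo : (P A < +oo)%E by rewrite ltey_eq fin_num_measure.
pose nu : {charge set T' -> \bar R} :=
  measure_function_pushforward__canonical__charge_Charge
    (charge_of_finite_measure (mfrestr mA PAoo)) mid.
pose P' : probability T' R := distribution P idG.
have dom : nu `<< P'.
  apply/null_content_dominatesP => N mN PN0.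
  have mN' : measurable (N : set Omega) by exact: sGm.
  apply/eqP; rewrite -measure_le0 -[leRHS]PN0.
  by apply: le_measure; rewrite ?inE//; exact: measurableI.
pose g : T' -> \bar R := 'd nu '/d P'.
have gfin w : g w \is a fin_num by exact: Radon_Nikodym_fin_num.
have gint : P'.-integrable setT g by exact: Radon_Nikodym_integrable.
have mg : measurable_fun [set: T'] (g : T' -> \bar R) by exact: measurable_int gint.
have gPint : P.-integrable setT g.
  apply/integrableP; split.
    exact: (@measurableT_comp _ _ _ _ _ _ g _ idG).
  have /integrableP[_] := gint.
  by rewrite ge0_integral_pushforward//; exact: measurableT_comp.
have gEF : EFin \o (fine \o g) = g by apply/funext => w /=; rewrite fineK.
exists (fine \o g); split; rewrite ?gEF//.
- move=> Y mY.
  have : measurable_fun setT (fine \o g : T' -> R) by exact: measurableT_comp.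
  by move=> /(_ measurableT Y mY); rewrite setTI.
- move=> E GE.
  transitivity (nu E); last by rewrite setIC.
  rewrite (Radon_Nikodym_integral dom GE) integral_pushforward//=.
    by apply: eq_integral => w _; rewrite fineK.
  by apply: integrableS gPint => //; exact: sGm.
Qed.

End Conditioning.

Section Data.
Context d (Omega : measurableType d) (R : realType) (P : probability Omega R).
Context (T : nat) (N : 'I_T -> nat).

(* The sigma-algebra generated by the complete boundary array [b] and by a
   further random element [W] (pilot sample and design information).  A
   constant [W] gives the sigma-algebra of the boundary array alone. *)
Definition design_sigma dX (X : measurableType dX)
    (b : forall t, 'I_(N t) -> {RV P >-> R}) (W : {RV P >-> X}) :
    set (set Omega) :=
  <<s [set E | (exists t (j : 'I_(N t)) (Y : set R),
                   measurable Y /\ E = b t j @^-1` Y)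
               \/ (exists Y : set X, measurable Y /\ E = W @^-1` Y)] >>.

Definition sales_log (D b : forall t, 'I_(N t) -> {RV P >-> R})
    (t : 'I_T) (j : 'I_(N t)) (w : Omega) : R := Num.min (D t j w) (b t j w).

(* min_{s >= t} lam_s; the seed [lam t w] belongs to the range. *)
Definition carry_safe_cap (lam : 'I_T -> Omega -> R) (t : 'I_T) (w : Omega) : R :=
  \big[Num.min/lam t w]_(s < T | (t <= s)%N) lam s w.

Definition admissible (b : forall t, 'I_(N t) -> {RV P >-> R})
    (a : 'I_T -> Omega -> R) (t : 'I_T) (w : Omega) : {set 'I_(N t)} :=
  [set j | a t w <= b t j w]%SET.

Definition admissible_count (b : forall t, 'I_(N t) -> {RV P >-> R})
    (a : 'I_T -> Omega -> R) (t : 'I_T) (w : Omega) : nat :=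
  #|admissible b a t w|.

Definition empirical_cdf_left (Z : forall t, 'I_(N t) -> Omega -> R)
    (b : forall t, 'I_(N t) -> {RV P >-> R})
    (a : 'I_T -> Omega -> R) (t : 'I_T) (w : Omega) : R :=
  ((admissible_count b a t w)%:R)^-1 *
  \sum_(j in admissible b a t w) (Z t j w < a t w)%R%:R.

Definition conf_radius (b : forall t, 'I_(N t) -> {RV P >-> R})
    (a : 'I_T -> Omega -> R) (delta : R) (t : 'I_T) (w : Omega) : R :=
  Num.sqrt (ln (2 * T%:R / delta) / (2 * (admissible_count b a t w)%:R)).

End Data.

Definition cdf_left d (Omega : measurableType d) (R : realType)
    (P : probability Omega R) (X : {RV P >-> R}) (u : R) : R :=
  fine (P [set w | X w < u]).

Definition critical_ratio (R : realType) (h p : R) : R := p / (h + p).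

(* Main.v *)
Require Import Defs.
From HB Require Import structures.
From mathcomp Require Import all_boot all_order all_algebra.
From mathcomp Require Import all_classical all_reals all_analysis.
From mathcomp Require Import measurable_realfun ring lra.

Set Implicit Arguments.
Unset Strict Implicit.
Unset Printing Implicit Defensive.

Import Order.TTheory GRing.Theory Num.Theory.
Import numFieldNormedType.Exports.

Local Open Scope classical_set_scope.
Local Open Scope ring_scope.

(* The fitting demands are jointly independent of the design sigma-algebra, so
   the conditional probability of an event depending on the design and on the
   demands is, almost surely, the probability obtained by freezing the design
   (Fubini on the product of the two sigma-algebras).  Once frozen, the caps
   and the admissible sets are deterministic, and Hoeffding's inequality for the
   independent indicators of [D_t^j < a_t] bounds each tail by delta / (2T); a
   union bound over the periods concludes.  For the second claim, the lower
   bound on m_t says that r_t <= gamma_t / 2. *)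

(** * Hoeffding's inequality for counts of independent events *)

Lemma is_derive_ge0_le (R : realType) (f df : R -> R) (a b : R) :
  (forall x : R, is_derive x (1 : R) f (df x)) ->
  (forall x, a <= x -> 0 <= df x) ->
  a <= b -> f a <= f b.
Proof.
move=> fdf df0 ab; apply: (ger0_derive1_ndecry (a := a)) => //.
- move=> x; rewrite in_itv/= andbT => /ltW /df0.
  by rewrite derive1E (derive_val (is_derive := fdf x)).
- apply: continuous_subspaceT => x; apply: differentiable_continuous.
  by apply/derivable1_diffP; exact: (ex_derive (is_derive := fdf x)).
Qed.

(** Hoeffding's lemma for a centred Bernoulli variable. The constant 8 comes from the bound 1/4 on
    the second derivative of the log moment generating function, integrated twice from 0. *)
Lemma bernoulli_mgf_le (R : realType) (p s : R) : 0 <= p <= 1 -> 0 <= s ->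
  p * expR (s * (1 - p)) + (1 - p) * expR (- (s * p)) <= expR (s ^+ 2 / 8).
Proof.
move=> /andP[p0 p1] s0.
pose u (x : R) : R := 1 - p + p * expR x.
have u0 x : 0 < u x.
  rewrite /u; have [->|pn0] := eqVneq p 0; first by rewrite subr0 mul0r addr0.
  by rewrite ltr_wpDl ?subr_ge0// mulr_gt0 ?expR_gt0// lt0r pn0.
have du (x : R) : is_derive x (1 : R) u (p * expR x).
  rewrite (_ : u = cst (1 - p) + p *: (expR : R -> R)); last exact/funext.
  by apply: is_derive_eq; rewrite add0r.
(* [f] is the logarithm of the right side over the left; [f 0 = f' 0 = 0] and,
   by AM-GM on the two summands of [u], [f'' >= 0]. *)
pose f x : R := x ^+ 2 / 8 + x * p - ln (u x).
pose df x : R := x / 4 + p - p * expR x / u x.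
pose ddf x : R := 1 / 4 - p * expR x * (1 - p) / u x ^+ 2.
have fdf (x : R) : is_derive x (1 : R) f (df x).
  have dlnu : is_derive x (1 : R) (@ln R \o u) ((u x)^-1 * (p * expR x)).
    by apply: is_derive1_comp; exact: is_derive1_ln.
  rewrite (_ : f = 8^-1 *: ((id : R -> R) ^+ 2) + p *: (id : R -> R) -
      (@ln R \o u)); last first.
    by apply/funext => y; rewrite /f !fctE /GRing.scale/=; ring.
  apply: is_derive_eq.
  rewrite /df /GRing.scale/=; field; exact: lt0r_neq0.
have dfddf (x : R) : is_derive x (1 : R) df (ddf x).
  have un0 : u x != 0 by exact: lt0r_neq0.
  have dVu : is_derive x (1 : R) (fun y => (u y)^-1)
      (- (u x) ^- 2 *: (p * expR x)).
    exact: is_deriveV.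
  rewrite (_ : df = 4^-1 *: (id : R -> R) + cst p -
      (p *: (expR : R -> R)) * (fun y => (u y)^-1)); last first.
    by apply/funext => y; rewrite /df !fctE /GRing.scale/=; ring.
  apply: is_derive_eq.
  by rewrite /ddf fctE /GRing.scale/= /u; field.
have ddf0 x : 0 <= x -> 0 <= ddf x.
  move=> _; rewrite /ddf subr_ge0 ler_pdivrMr ?exprn_gt0// -subr_ge0.
  rewrite (_ : _ - _ = ((p * expR x - (1 - p)) / 2) ^+ 2) ?sqr_ge0//.
  by rewrite /u; field.
have df0 x : 0 <= x -> 0 <= df x.
  move=> x0; rewrite (_ : 0 = df 0); first exact: (is_derive_ge0_le dfddf ddf0).
  by rewrite /df /u expR0 mulr1 subrK divr1 mul0r add0r subrr.
have := is_derive_ge0_le fdf df0 s0.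
rewrite /f /u expR0 mulr1 subrK ln1 expr0n/= !mul0r !addr0 subr0 subr_ge0 => h.
rewrite (_ : _ + _ = u s * expR (- (s * p))); last first.
  rewrite /u mulrBr mulr1 expRD; ring.
rewrite -[u s]lnK ?posrE// -expRD ler_expR /u; lra.
Qed.

(** The sum is an upper binomial tail, indexed by the set [K] of successes among the trials in [J];
    this keeps the Chernoff argument purely finite. *)
Lemma binomial_tail_le (R : realType) (I : finType) (J : {set I}) (p r : R) :
  0 <= p <= 1 -> 0 <= r ->
  \sum_(K : {set I} | (K \subset J) && (#|J|%:R * (p + r) <= #|K|%:R))
     \prod_(i in J) (if i \in K then p else 1 - p) <=
  expR (- (2 * #|J|%:R * r ^+ 2)).
Proof.
move=> p01 r0; have [p0 p1] := andP p01.
(* Chernoff's bound with the exponent [s = 4 * r], which minimizes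
   [s ^+ 2 / 8 - s * r]. *)
set m := #|J|; pose s := 4 * r.
(* The values 0 and 1 off [J] make the expanded product over all indices charge only subsets of [J],
   with factor 1 at each index off [J]. *)
pose q i : R := if i \in J then p * expR s else 0.
pose q' i : R := if i \in J then 1 - p else 1.
have q0 i : 0 <= q i.
  by rewrite /q; case: ifP => // _; rewrite mulr_ge0 ?expR_ge0.
have q'0 i : 0 <= q' i by rewrite /q'; case: ifP => // _; rewrite subr_ge0.
pose e := expR (- (s * (m%:R * (p + r)))).
have -> : expR (- (2 * m%:R * r ^+ 2)) =
    e * (expR (s * p) * expR (s ^+ 2 / 8)) ^+ m.
  by rewrite -expRD -expRM_natl -expRD; congr expR; rewrite /s; field.
have mgf : p * expR s + (1 - p) <= expR (s * p) * expR (s ^+ 2 / 8).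
  have := bernoulli_mgf_le p01 (s := s); rewrite mulr_ge0// => /(_ isT).
  rewrite -(ler_pM2l (expR_gt0 (s * p))); apply: le_trans.
  rewrite le_eqVlt; apply/orP; left; apply/eqP.
  rewrite mulrDr mulrCA -expRD [X in _ = _ + X]mulrCA -expRD subrr expR0 mulr1.
  by congr (_ * expR _ + _); ring.
apply: (@le_trans _ _ (e * \prod_i (q i + q' i))); last first.
  rewrite ler_pM2l ?expR_gt0// (bigID (mem J))/= mulrC big1 ?mul1r; last first.
    by move=> i /negPf; rewrite /q /q' => ->; rewrite add0r.
  rewrite -prodr_const; apply: ler_prod => i iJ.
  by rewrite addr_ge0//= /q /q' iJ.
(* Markov's inequality termwise: a set [K] in the tail carries the extra factor
   [e * expR (s * #|K|)], which is at least 1; the other terms are nonnegative. *)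
rewrite bigA_distr mulr_sumr big_mkcond/=; apply: ler_sum => K _.
have pi0 : 0 <= \prod_i (if i \in K then q i else q' i).
  by apply: prodr_ge0 => i _; case: ifP.
case: ifPn => [/andP[KJ Km]|_]; last by rewrite mulr_ge0 ?expR_ge0.
rewrite [X in _ <= _ * X](bigID (mem J))/=.
rewrite [X in _ * (_ * X)]big1 ?mulr1; last first.
  move=> i iJ; rewrite /q' (negPf iJ); case: ifP => // /(fintype.subsetP KJ).
  by rewrite (negPf iJ).
rewrite [X in _ <= _ * X](eq_bigr (fun i => (if i \in K then expR s else 1) *
    (if i \in K then p else 1 - p))); last first.
  by move=> i iJ; rewrite /q /q' iJ; case: ifP => _; rewrite ?mul1r// mulrC.
rewrite big_split/= mulrA ler_peMl//.
  by apply: prodr_ge0 => i _; case: ifP; rewrite ?subr_ge0.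
rewrite -big_mkcondr/= (eq_bigl (mem K)); last first.
  by move=> i /=; rewrite andb_idl// => /(fintype.subsetP KJ).
rewrite prodr_const -expRM_natl -expRD -[leLHS]expR0 ler_expR addrC subr_ge0.
by rewrite (mulrC s) ler_wpM2r// mulr_ge0.
Qed.

Lemma measure_bigsetU_le d (T : measurableType d) (R : realType)
    (mu : {measure set T -> \bar R}) (I : Type) (s : seq I) (Q : pred I)
    (E : I -> set T) :
  (forall i, measurable (E i)) ->
  (mu (\big[setU/set0]_(i <- s | Q i) E i) <= \sum_(i <- s | Q i) mu (E i))%E.
Proof.
move=> mE.
suff [] : measurable (\big[setU/set0]_(i <- s | Q i) E i) /\
    (mu (\big[setU/set0]_(i <- s | Q i) E i) <=
     \sum_(i <- s | Q i) mu (E i))%E by [].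
elim/big_rec2 : _ => [|i y A _ [mA PA]]; first by rewrite measure0.
split; first exact: measurableU.
by rewrite (le_trans (measureU2 _ _ _))// leeD.
Qed.

Lemma measurable_fun_nat_of_bool d (T : measurableType d) (R : realType)
    (b : T -> bool) :
  measurable_fun setT b -> measurable_fun setT (fun x => (b x)%:R : R).
Proof.
move=> mb; rewrite (_ : (fun _ => _) = fun x => if b x then 1 else 0).
  exact: measurable_fun_ifT.
by apply/funext => x; case: (b x).
Qed.

Lemma measurable_fun_count d (T : measurableType d) (R : realType)
    (I : finType) (J : {set I}) (b : I -> T -> bool) :
  (forall i, measurable_fun setT (b i)) ->
  measurable_fun setT (fun x => \sum_(i in J) (b i x)%:R : R).
Proof.
move=> mb; under eq_fun do rewrite big_mkcond.
apply: measurable_sum => i; case: (i \in J) => //.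
exact: measurable_fun_nat_of_bool.
Qed.

(** The event is covered by cells, one for each possible set [K] of indices in [J] with [X i] in
    [V i]. Independence gives each cell its product weight, and the binomial tail bounds the sum. *)
Lemma hoeffding_count d (Omega : measurableType d) (R : realType)
    (P : probability Omega R) (I : finType) (X : I -> {RV P >-> R})
    (J : {set I}) (V : I -> set R) (p r : R) :
  mutually_independent X -> (forall i, measurable (V i)) ->
  {in J, forall i, P (X i @^-1` V i) = p%:E} -> 0 <= p <= 1 -> 0 <= r ->
  (P [set w | (#|J|%:R * (p + r) <= \sum_(i in J) (X i w \in V i)%:R)%R] <=
    (expR (- (2 * #|J|%:R * r ^+ 2)))%:E)%E.
Proof.
move=> indX mV PV p01 r0.
have mXV i (A : set R) : measurable A -> measurable (X i @^-1` A).
  by move=> mA; rewrite -[X in measurable X]setTI; exact: measurable_funP.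
pose V' (K : {set I}) i := if i \in K then V i else ~` V i.
have mV' K i : measurable (V' K i).
  by rewrite /V'; case: ifP => // _; exact: measurableC.
pose E (K : {set I}) := \bigcap_(i in [set` J]) X i @^-1` V' K i.
have PE K : P (E K) = (\prod_(i in J) (if i \in K then p else 1 - p))%:E.
  rewrite indX// -prodEFin; apply: eq_bigr => i iJ; rewrite /V'.
  case: ifP => // _; first exact: PV.
  by rewrite preimage_setC probability_setC ?PV//; exact: mXV.
have mE K : measurable (E K).
  by apply: fin_bigcap_measurable => // i _; exact: mXV.
pose Q (K : {set I}) := (K \subset J) && (#|J|%:R * (p + r) <= #|K|%:R).
have sub : [set w | #|J|%:R * (p + r) <= \sum_(i in J) (X i w \in V i)%:R] `<=`
    \big[setU/set0]_(K | Q K) E K.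
  move=> w /= hw; pose K := [set i in J | X i w \in V i]%SET.
  rewrite -bigcup_seq_cond; exists K.
    rewrite /= mem_index_enum; apply/andP; split => //; apply/andP; split.
      by apply/fintype.subsetP => i; rewrite inE => /andP[].
    rewrite (le_trans hw)// -natr_sum ler_nat -sum1_card big_mkcond/=.
    rewrite [leqRHS]big_mkcond/=; apply: leq_sum => i _.
    by rewrite inE; case: (i \in J) => //=; case: (_ \in _).
  move=> i /= iJ; rewrite /V' inE iJ/=.
  by case: ifPn; [rewrite inE|rewrite notin_setE].
have mU : measurable (\big[setU/set0]_(K | Q K) E K).
  by apply: bigsetU_measurable.
have mcount : measurable
    [set w | #|J|%:R * (p + r) <= \sum_(i in J) (X i w \in V i)%:R].
  rewrite -[X in measurable X]setTI.
  apply: (@measurable_fun_ler _ _ _ setT (cst (#|J|%:R * (p + r)))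
    (fun w => \sum_(i in J) (X i w \in V i)%:R)) => //.
  apply: measurable_fun_count => i; apply: (measurable_fun_bool true).
  rewrite setTI (_ : _ @^-1` _ = X i @^-1` V i); first exact: mXV.
  by apply/seteqP; split => w /=; [exact: set_mem|exact: mem_set].
apply: le_trans (le_measure _ _ _ sub) _; rewrite ?inE//.
apply: le_trans (measure_bigsetU_le _ _ _ mE) _.
rewrite (eq_bigr _ (fun K _ => PE K)) sumEFin lee_fin.
exact: binomial_tail_le.
Qed.

(** * Independence of generated sigma-algebras, and freezing *)

Lemma independent_g_sigma_algebra d (Omega : measurableType d) (R : realType)
    (P : probability Omega R) (S : set (set Omega)) (E : set Omega) :
  measurable E -> S `<=` measurable -> setI_closed S -> S setT ->
  (forall B, S B -> (P (E `&` B) = P E * P B)%E) ->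
  forall B, <<s S >> B -> (P (E `&` B) = P E * P B)%E.
Proof.
move=> mE Sm SI ST indS B SB.
have PEoo : (P E < +oo)%E by rewrite ltey_eq fin_num_measure.
have PE0 : 0 <= fine (P E) by rewrite fine_ge0.
have PEK : (fine (P E))%:E = P E by rewrite fineK ?fin_num_measure.
transitivity (mfrestr mE PEoo B); first by rewrite /mfrestr/= /mrestr setIC.
rewrite -PEK.
(* The finite measures sending [B] to [P (E & B)] and to [P E * P B] agree on the pi-system [S],
   which contains the whole space. *)
apply: (g_sigma_algebra_measure_unique S Sm (fun=> setT) _ _
  (mfrestr mE PEoo) (mscale (NngNum PE0) P)) => //=.
- by rewrite bigcup_const.
- by move=> A SA; rewrite /mfrestr/= /mrestr setIC indS// /mscale/= PEK.
- by move=> _; rewrite /mfrestr/= /mrestr setTI.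
Qed.

(* Freezing: since S is independent of GG, the map [w |-> (w, w)] sends [P] to a
   product measure on the two generated sigma-algebras, so [P (xsection C w)] is
   a version of the conditional probability of [C (w, w)]. *)
Lemma cond_prob_ge_section d (Omega : measurableType d) (R : realType)
    (P : probability Omega R) (GG S : set (set Omega))
    (C : set (g_sigma_algebraType GG * g_sigma_algebraType S))
    (f : Omega -> R) :
  GG `<=` measurable -> S `<=` measurable -> setI_closed S -> S setT ->
  (forall E B, <<s GG >> E -> S B -> (P (E `&` B) = P E * P B)%E) ->
  measurable C -> is_cond_prob P <<s GG >> [set w | C (w, w)] f ->
  {ae P, forall w, (P (xsection C w) <= (f w)%:E)%E}.
Proof.
move=> GGm Sm SI ST indS mC [Gf fint fE].
have sub (U : set (set Omega)) : U `<=` measurable -> <<s U >> `<=` measurable.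
  by move=> Um; apply: smallest_sub => //; exact: sigma_algebra_measurable.
pose T1 : measurableType _ := g_sigma_algebraType GG.
pose T2 : measurableType _ := g_sigma_algebraType S.
have mid1 : measurable_fun setT (idfun : Omega -> T1).
  by move=> _ Y mY; rewrite setTI; exact: sub mY.
have mid2 : measurable_fun setT (idfun : Omega -> T2).
  by move=> _ Y mY; rewrite setTI; exact: sub mY.
have mdiag : measurable_fun setT (fun w : Omega => (w, w) : T1 * T2).
  exact: measurable_fun_pair.
pose id1 : {mfun Omega >-> T1} := HB.pack (idfun : Omega -> T1)
  (isMeasurableFun.Build _ _ _ _ _ mid1).
pose id2 : {mfun Omega >-> T2} := HB.pack (idfun : Omega -> T2)
  (isMeasurableFun.Build _ _ _ _ _ mid2).
pose diag : {mfun Omega >-> (T1 * T2)%type} :=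
  HB.pack (fun w : Omega => (w, w) : T1 * T2)
  (isMeasurableFun.Build _ _ _ _ _ mdiag).
pose P1 : probability T1 R := distribution P id1.
pose P2 : probability T2 R := distribution P id2.
(* The law of the diagonal map factors on rectangles by independence; uniqueness of the product
   measure extends this to every [D]. *)
have prodE (D : set (T1 * T2)) : measurable D ->
    (P1 \x P2)%E D = P [set w | D (w, w)].
  move=> mD; transitivity (distribution P diag D); last by [].
  refine (@product_measure_unique _ _ T1 T2 R P1 P2
    (distribution P diag) _ D mD).
  move=> E B mE mB.
  rewrite -(independent_g_sigma_algebra (S := S) (E := E))//;
    first exact: sub mE.
  by move=> ? ?; exact: indS.
pose g (w : T1) : \bar R := P2 (xsection C w).
have mg : measurable_fun setT g by exact: measurable_fun_xsection.
have mf : measurable_fun setT (EFin \o (f : T1 -> R)).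
  by apply/measurable_EFinP => _ Y mY; rewrite setTI; exact: Gf.
have intf (E : set T1) : measurable E ->
    (\int[P1]_(x in E) (f x)%:E = \int[P]_(x in E) (f x)%:E)%E.
  move=> mE; apply: (integral_pushforward mid1 mf) => //.
  by apply: integrableS fint => //; exact: sub mE.
have f1int : P1.-integrable setT (EFin \o (f : T1 -> R)).
  apply/integrableP; split => //; have /integrableP[_] := fint.
  by rewrite ge0_integral_pushforward//; exact: measurableT_comp.
have fg : ae_eq P1 setT (EFin \o f) g.
  apply: integral_ae_eq => // E _ mE.
  rewrite intf// fE//.
  (* The mass of the diagonal event over [E] is the product measure of [C] cut to the strip over
     [E], that is, the integral over [E] of the section probabilities. *)
  rewrite -[LHS](_ : (P1 \x P2)%E (C `&` (E `*` setT)) = _); last first.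
    rewrite prodE; last by apply: measurableI => //; exact: measurableX.
    by congr (P _); apply/seteqP; split => [w [? [? _]]|w [? ?]].
  rewrite /product_measure1 /= [RHS]integral_mkcond; apply: eq_integral => w _.
  rewrite patchE; case: ifPn => wE.
    congr (P2 _); apply/seteqP.
    split => y; rewrite /xsection/= !inE; first by case.
    by move=> ?; split=> //; split => //; exact: set_mem.
  rewrite (_ : xsection _ _ = set0) ?measure0//.
  apply/seteqP; split => y //; rewrite /xsection/= inE => -[_ [/= wE' _]].
  by move: wE; rewrite notin_setE.
case: fg => N [mN PN sN]; exists N; split => //; first exact: sub mN.
move=> w /= nw; apply: sN => /= fgw; apply: nw.
by rewrite fgw.
Qed.

Lemma cond_prob_cst d (Omega : measurableType d) (R : realType)
    (P : probability Omega R) (G : set (set Omega)) (A E : set Omega) (c : R) :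
  is_cond_prob P G A (fun=> c) -> G E -> measurable E ->
  (P (E `&` A) = P E * c%:E)%E.
Proof.
by case=> _ _ + GE mE => /(_ E GE); rewrite integral_cst// setIC muleC => ->.
Qed.

(** Since the conditional laws are nonrandom, the product of their constant versions is again
    constant; conditional independence thus becomes unconditional independence of the whole family
    from [G]. *)
Lemma cond_indep_law_prod d (Omega : measurableType d) (R : realType)
    (P : probability Omega R) (G : set (set Omega)) (I : finType)
    (X : I -> {RV P >-> R}) (mu : I -> set R -> \bar R) :
  G `<=` measurable -> G setT ->
  cond_mutually_independent G X -> (forall i, cond_law G (X i) (mu i)) ->
  forall E (J : {set I}) (A : I -> set R),
    G E -> (forall i, measurable (A i)) ->
  (P (E `&` \bigcap_(i in [set` J]) X i @^-1` A i) =
   P E * \prod_(i in J) P (X i @^-1` A i))%E.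
Proof.
move=> Gm GT indX lawX E J A GE mA.
rewrite (cond_prob_cst (indX J A _ mA (fun i => lawX i _ (mA i))))//;
  last exact: Gm.
congr (_ * _)%E; rewrite -prodEFin; apply: eq_bigr => i _.
rewrite -[X i @^-1` A i]setTI (cond_prob_cst (lawX i _ (mA i)))//.
by rewrite probability_setT mul1e.
Qed.

Lemma mutually_independent_comp d (Omega : measurableType d) (R : realType)
    (P : probability Omega R) (I K : finType) (X : I -> {RV P >-> R})
    (e : K -> I) :
  injective e -> mutually_independent X -> mutually_independent (X \o e).
Proof.
move=> inje indX J A mA.
(* By injectivity this is [A k] at [e k], and the full set at an index outside the image of [e]. *)
pose A' i := \bigcap_(k in [set k | e k = i]) A k.
have A'e k : A' (e k) = A k.
  apply/seteqP; split => x; first by apply.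
  by move=> Ax l /= /inje ->.
have -> : \bigcap_(k in [set` J]) (X \o e) k @^-1` A k =
    \bigcap_(i in [set` (e @: J)%SET]) X i @^-1` A' i.
  apply/seteqP; split => w Aw.
    by move=> _ /= /imsetP[k kJ ->]; rewrite A'e; exact: Aw.
  by move=> k /= kJ; rewrite -A'e; apply: Aw; exact: imset_f.
rewrite indX; last by move=> i; apply: fin_bigcap_measurable.
rewrite big_imset/=; last by move=> ? ? _ _; exact: inje.
by apply: eq_bigr => k _; rewrite A'e.
Qed.

(** * Deviations of the empirical distribution function, and the union bound *)

Lemma hoeffding_cdf_upper d (Omega : measurableType d) (R : realType)
    (P : probability Omega R) (I : finType) (X : I -> {RV P >-> R})
    (J : {set I}) (u p r : R) :
  mutually_independent X ->
  {in J, forall i, P [set w | X i w < u] = p%:E} -> 0 <= p <= 1 -> 0 <= r ->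
  (P [set w | (#|J|%:R * (p + r) <= \sum_(i in J) (X i w < u)%R%:R)%R] <=
    (expR (- (2 * #|J|%:R * r ^+ 2)))%:E)%E.
Proof.
move=> indX Pu p01 r0.
have mV : measurable [set x : R | x < u] by rewrite -set_itvNyo.
have := hoeffding_count indX (fun=> mV) Pu p01 r0.
congr (P _ <= _)%E; apply/funext => w /=.
have memV x : (x \in [set y : R | y < u]) = (x < u).
  by apply/idP/idP => [/set_mem//|?]; exact: mem_set.
by under eq_bigr do rewrite memV.
Qed.

(** Few successes means many failures: the counting bound applies to the complementary events, of
    probability [1 - p]. *)
Lemma hoeffding_cdf_lower d (Omega : measurableType d) (R : realType)
    (P : probability Omega R) (I : finType) (X : I -> {RV P >-> R})
    (J : {set I}) (u p r : R) :
  mutually_independent X ->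
  {in J, forall i, P [set w | X i w < u] = p%:E} -> 0 <= p <= 1 -> 0 <= r ->
  (P [set w | (\sum_(i in J) (X i w < u)%R%:R <= #|J|%:R * (p - r))%R] <=
    (expR (- (2 * #|J|%:R * r ^+ 2)))%:E)%E.
Proof.
move=> indX Pu /andP[p0 p1] r0.
have mV' : measurable [set x : R | x < u] by rewrite -set_itvNyo.
have mV : measurable (~` [set x : R | x < u]) by exact: measurableC.
have PV : {in J, forall i, P (X i @^-1` ~` [set x | x < u]) = (1 - p)%:E}.
  move=> i iJ; rewrite preimage_setC probability_setC; first by rewrite Pu.
  rewrite -[X in measurable X]setTI.
  exact: (@measurable_funP _ _ _ _ setT (X i) measurableT _ mV').
have p01 : 0 <= 1 - p <= 1 by rewrite subr_ge0 p1/= lerBlDr lerDl.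
have := hoeffding_count indX (fun=> mV) PV p01 r0.
congr (P _ <= _)%E; apply/funext => w /=.
have -> : \sum_(i in J) (X i w \in ~` [set x | x < u])%:R =
    #|J|%:R - \sum_(i in J) (X i w < u)%R%:R :> R.
  rewrite -sum1_card natr_sum -sumrB; apply: eq_bigr => i _.
  have -> : (X i w \in ~` [set x | x < u]) = ~~ (X i w < u).
    by apply/idP/idP => [/set_mem/negP//|/negP ?]; exact: mem_set.
  by case: (_ < _)%R; rewrite ?subrr ?subr0.
apply/propext; rewrite mulrDr mulrBr mulrBr mulr1; split => h; lra.
Qed.

(** The radius makes the Hoeffding exponent equal to the logarithm of [2 * T / delta]. This ratio is
    at least 1, so the square root is not truncated to 0. *)
Lemma conf_radius_tail (R : realType) (T m : nat) (delta : R) :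
  (0 < T)%N -> (0 < m)%N -> 0 < delta < 1 ->
  expR (- (2 * m%:R * Num.sqrt (ln (2 * T%:R / delta) / (2 * m%:R)) ^+ 2)) =
  delta / (2 * T%:R).
Proof.
move=> T0 m0 /andP[d0 d1].
have T1 : 1 <= T%:R :> R by rewrite ler1n.
have m1 : 1 <= m%:R :> R by rewrite ler1n.
have x1 : 1 <= 2 * T%:R / delta by rewrite ler_pdivlMr//; lra.
have L0 : 0 <= ln (2 * T%:R / delta) by rewrite ln_ge0.
rewrite sqr_sqrtr; last by rewrite divr_ge0// mulr_ge0.
rewrite mulrC divfK; last by rewrite mulf_neq0// gt_eqF//; lra.
rewrite expRN lnK ?posrE; last by rewrite (lt_le_trans _ x1).
by rewrite invf_div.
Qed.

(** Each claim fails only through one-sided deviations, so the union over the periods costs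
    [delta / 2], within the budget [delta]. *)
Lemma probability_ge_of_cover d (Omega : measurableType d) (R : realType)
    (P : probability Omega R) (T : nat) (C : set Omega) (B : 'I_T -> set Omega)
    (delta : R) :
  0 <= delta -> measurable C -> (forall t, measurable (B t)) ->
  (forall t, P (B t) <= (delta / (2 * T%:R))%:E)%E ->
  ~` C `<=` \bigcup_t B t -> ((1 - delta)%:E <= P C)%E.
Proof.
move=> d0 mC mB PB sub.
have mCc : measurable (~` C) by exact: measurableC.
have : (P (~` C) <= delta%:E)%E.
  have mU : measurable (\big[setU/set0]_(t < T) B t).
    by apply: bigsetU_measurable.
  have sub' : ~` C `<=` \big[setU/set0]_(t < T) B t.
    move=> w /sub[t _ Btw]; rewrite -bigcup_seq; exists t => //=.
    by rewrite mem_index_enum.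
  apply: le_trans (le_measure _ _ _ sub') _; rewrite ?inE//.
  apply: le_trans (measure_bigsetU_le _ _ _ mB) _.
  apply: (@le_trans _ _ (\sum_(t < T) (delta / (2 * T%:R))%:E)%E).
    by apply: lee_sum => t _; exact: PB.
  rewrite sumEFin lee_fin sumr_const card_ord.
  have [->|T0] := posnP T; first by rewrite mulr0n.
  have T1 : (0 : R) < T%:R by rewrite ltr0n.
  rewrite (_ : _ *+ _ = delta / 2); first lra.
  rewrite -[LHS]mulr_natr.
  by field; rewrite gt_eqF.
rewrite probability_setC//.
rewrite -(@fineK _ (P C)) ?fin_num_measure// -EFinB !lee_fin; lra.
Qed.

(** Half the margin is the target because the radius is spent twice: once on the sampling error and
    once on the subtraction in the test. *)
Lemma sqrt_div_le_half (R : realType) (L g : R) (m : nat) :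
  (0 < m)%N -> 0 < g -> 2 * g ^- 2 * L < m%:R ->
  Num.sqrt (L / (2 * m%:R)) <= g / 2.
Proof.
move=> m0 g0; rewrite mulrAC ltr_pdivrMr ?exprn_gt0// => hL.
have m1 : (0 : R) < m%:R by rewrite ltr0n.
have g20 : 0 <= g / 2 by rewrite divr_ge0// ltW.
rewrite -[leRHS](ger0_norm g20) -sqrtr_sqr ler_wsqrtr//.
by rewrite ler_pdivrMr ?mulr_gt0//; lra.
Qed.

Theorem proposition6 (R : realType) (T : nat) (h p : 'I_T -> R) (Dbar : R)
  (h_gt0 : forall t, 0 < h t) (p_gt0 : forall t, 0 < p t) (Dbar_gt0 : 0 < Dbar)
  (* the demands D_t, with laws P_t = distribution P0 (dem t) *)
  (d0 : measure_display) (Omega0 : measurableType d0)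
  (P0 : probability Omega0 R) (dem : 'I_T -> {RV P0 >-> R})
  (dem_indep : mutually_independent dem)
  (dem_supp : forall t, distribution P0 (dem t) `[0, Dbar] = 1%E)
  (* offline data: boundaries b_t^j and latent fitting demands D_t^j *)
  (d : measure_display) (Omega : measurableType d) (P : probability Omega R)
  (N : 'I_T -> nat) (b D : forall t, 'I_(N t) -> {RV P >-> R})
  (b_ge0 : forall t j w, 0 <= b t j w)
  (* pilot and design information *)
  (dX : measure_display) (X : measurableType dX) (W : {RV P >-> X})
  (* conditional noninformative censoring *)
  (D_indep : cond_mutually_independent (design_sigma b W)
     (fun i : {t : 'I_T & 'I_(N t)} => D (tag i) (tagged i)))
  (D_law : forall t j,
     cond_law (design_sigma b W) (D t j) (distribution P0 (dem t)))
  (delta : R) (delta_gt0 : 0 < delta) (delta_lt1 : delta < 1)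
  (* caps chosen from the design information and the boundaries *)
  (lam : 'I_T -> Omega -> R)
  (lam_range : forall t w, 0 <= lam t w <= Dbar)
  (lam_design : forall t, sigma_measurable (design_sigma b W) (lam t)) :
  let G := design_sigma b W in
  let q t := critical_ratio (h t) (p t) in
  let F t := cdf_left (dem t) in
  let a := carry_safe_cap lam in
  let Z := sales_log D b in
  let m := admissible_count b a in
  let Fhat := empirical_cdf_left Z b a in
  let r := conf_radius b a delta in
  let passes w := forall t, q t < Fhat t w - r t w in
  let covers w := forall t, q t < F t (a t w) in
  [/\ forall t w j, j \in admissible b a t w ->
        (Z t j w < a t w) = (D t j w < a t w),
      cond_prob_ge_on P G [set w | passes w -> covers w] (1 - delta)
        [set w | forall t, (1 <= m t w)%N] &
      cond_prob_ge_on P G [set w | passes w] (1 - delta)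
        [set w | (forall t, (1 <= m t w)%N) /\
           exists gamma : 'I_T -> R, forall t,
             [/\ 0 < gamma t,
                 q t + gamma t <= F t (a t w) &
                 2 * (gamma t) ^- 2 * ln (2 * T%:R / delta) < (m t w)%:R]]].
Proof.
move=> G q F a Z m Fhat r passes covers.

(* Independence of the design and the fitting demands *)
pose I := {t : 'I_T & 'I_(N t)}.
pose Y (i : I) := D (tag i) (tagged i).
pose GG := [set E | (exists t (j : 'I_(N t)) (B : set R),
    measurable B /\ E = b t j @^-1` B)
  \/ (exists B : set X, measurable B /\ E = W @^-1` B)].
(* Cylinders constrain every index, possibly by the full set, so that intersecting two of them is
   done coordinatewise. *)
pose S := [set B | exists A : I -> set R, (forall i, measurable (A i)) /\
  B = \bigcap_(i in [set` [set: I]%SET]) Y i @^-1` A i].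
have mpre dY (T' : measurableType dY) (V : {RV P >-> T'}) (B : set T') :
    measurable B -> measurable (V @^-1` B).
  by move=> mB; rewrite -[X in measurable X]setTI; exact: measurable_funP.
have GGm : GG `<=` measurable.
  by move=> _ [[t [j [B [mB ->]]]]|[B [mB ->]]]; exact: mpre.
have Gm : G `<=` measurable.
  by apply: smallest_sub => //; exact: sigma_algebra_measurable.
have Sm : S `<=` measurable.
  by move=> _ [A [mA ->]]; apply: fin_bigcap_measurable => // i _; exact: mpre.
have SI : setI_closed S.
  move=> _ _ [A [mA ->]] [A' [mA' ->]]; exists (fun i => A i `&` A' i); split.
    by move=> i; exact: measurableI.
  by rewrite -bigcapI.
have ST : S setT.
  by exists (fun=> setT); split => //; apply/seteqP; split.
have GT : G setT by exact: (@measurableT _ (g_sigma_algebraType GG)).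
have prodI := cond_indep_law_prod Gm GT D_indep
  (fun i => D_law (tag i) (tagged i)).
have indY : mutually_independent Y.
  move=> J A mA; have := prodI setT J A GT mA.
  by rewrite setTI probability_setT mul1e.
have indS E B : G E -> S B -> (P (E `&` B) = P E * P B)%E.
  by move=> GE [A [mA ->]]; rewrite prodI// indY.
have indD t : mutually_independent (D t).
  pose e := Tagged (fun t => 'I_(N t)) (i := t).
  apply: (mutually_independent_comp (e := e) _ indY).
  by move=> j k /eqP; rewrite eq_Tagged/= => /eqP.
have mlt u : measurable [set x : R | x < u] by rewrite -set_itvNyo.
have mdem t u : measurable [set w | dem t w < u].
  rewrite -[X in measurable X]setTI.
  exact: (@measurable_funP _ _ _ _ setT (dem t) measurableT _ (mlt u)).
have F01 t u : 0 <= F t u <= 1.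
  by rewrite fine_ge0//= -lee_fin fineK ?fin_num_measure// probability_le1.
have DF t j u : P [set w | D t j w < u] = (F t u)%:E.
  rewrite -[LHS](_ : P (setT `&` D t j @^-1` [set x | x < u]) = _);
    last by rewrite setTI.
  by rewrite (cond_prob_cst (D_law t j _ (mlt u)))// probability_setT mul1e.
have ZD t w j :
    j \in admissible b a t w -> (Z t j w < a t w) = (D t j w < a t w).
  by rewrite inE => ab; rewrite /Z /sales_log gt_min [X in _ || X]ltNge ab orbF.
(* Caps and boundaries are evaluated at [w], fitting demands at [w']. *)
pose Fh t (w w' : Omega) := ((m t w)%:R)^-1 *
  \sum_(j in admissible b a t w) (D t j w' < a t w)%R%:R : R.
have FhE t w : Fhat t w = Fh t w w.
  by congr (_ * _); apply: eq_bigr => j /ZD ->.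

(* Tail bounds at a frozen design *)
have r0 t w : 0 <= r t w by exact: sqrtr_ge0.
have rtail t w : (1 <= m t w)%N ->
    expR (- (2 * #|admissible b a t w|%:R * r t w ^+ 2)) = delta / (2 * T%:R).
  move=> m1; apply: conf_radius_tail; rewrite ?delta_gt0//.
  exact: leq_ltn_trans (ltn_ord t).
pose up t w := [set w' | ((m t w)%:R * (F t (a t w) + r t w) <=
  \sum_(j in admissible b a t w) (D t j w' < a t w)%R%:R)%R].
pose low t w := [set w' |
  (\sum_(j in admissible b a t w) (D t j w' < a t w)%R%:R <=
  (m t w)%:R * (F t (a t w) - r t w))%R].
have Pup t w : (1 <= m t w)%N -> (P (up t w) <= (delta / (2 * T%:R))%:E)%E.
  move=> m1; rewrite -(rtail t w m1).
  by apply: (hoeffding_cdf_upper (indD t)) => // j _; exact: DF.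
have Plow t w : (1 <= m t w)%N -> (P (low t w) <= (delta / (2 * T%:R))%:E)%E.
  move=> m1; rewrite -(rtail t w m1).
  by apply: (hoeffding_cdf_lower (indD t)) => // j _; exact: DF.
have mcount t w : measurable_fun setT (fun w' =>
    \sum_(j in admissible b a t w) (D t j w' < a t w)%R%:R : R).
  apply: measurable_fun_count => j; apply: measurable_fun_ltr => //.
have mup t w : measurable (up t w).
  rewrite -[X in measurable X]setTI.
  exact: (measurable_fun_ler (measurable_cst _) (mcount t w) measurableT
    (Y := [set true])).
have mlow t w : measurable (low t w).
  rewrite -[X in measurable X]setTI.
  exact: (measurable_fun_ler (mcount t w) (measurable_cst _) measurableT
    (Y := [set true])).

(* Joint measurability in the design and demand coordinates *)
pose T1 : measurableType _ := g_sigma_algebraType GG.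
pose T2 : measurableType _ := g_sigma_algebraType S.
have mlam t : measurable_fun setT (lam t : T1 -> R).
  by move=> _ B mB; rewrite setTI; exact: lam_design.
have ma t : measurable_fun setT (a t : T1 -> R).
  rewrite /a /carry_safe_cap; elim: (index_enum _) => [|s l IH].
    by rewrite (_ : (fun _ => _) = lam t)//; apply/funext => w; rewrite big_nil.
  under eq_fun do rewrite big_cons.
  by case: (t <= s)%N => //; exact: measurable_minr.
have mb t j : measurable_fun setT (b t j : T1 -> R).
  move=> _ B mB; rewrite setTI; apply: sub_sigma_algebra.
  by left; exists t, j, B.
have mD t j : measurable_fun setT (D t j : T2 -> R).
  move=> _ B mB; rewrite setTI; apply: sub_sigma_algebra.
  pose i0 : I := Tagged (fun t => 'I_(N t)) j.
  (* The cylinder constraining only the coordinate of [D t j]. *)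
  exists (fun i => if i0 == i then B else setT).
  split; first by move=> i; case: ifP.
  apply/seteqP; split => [w Bw i _ /=|w /(_ i0)/=]; first by case: eqP => // <-.
  by rewrite eqxx; apply; rewrite inE.
have mm t : measurable_fun setT (m t : T1 -> nat).
  rewrite (_ : m t = fun w => \sum_j (a t w <= b t j w)%R)%N; last first.
    apply/funext => w; rewrite /m /admissible_count -sum1_card big_mkcond/=.
    by apply: eq_bigr => j _; rewrite inE; case: (_ <= _)%R.
  elim: (index_enum _) => [|s l IH].
    rewrite (_ : (fun _ => _) = cst 0%N)//.
    by apply/funext => w; rewrite big_nil.
  under eq_fun do rewrite big_cons.
  apply: measurable_fun_addn => //.
  exact: (measurableT_comp (f := nat_of_bool))
    (measurable_fun_ler (ma t) (mb t s)).
have mr t : measurable_fun setT (r t : T1 -> R).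
  exact: (measurableT_comp (f := fun k : nat =>
    Num.sqrt (ln (2 * T%:R / delta) / (2 * k%:R)))).
have mFa t : measurable_fun setT (fun w : T1 => F t (a t w)).
  apply: (measurableT_comp (f := F t)) => //.
  apply: nondecreasing_measurable => // u v uv.
  rewrite fine_le ?fin_num_measure//; apply: le_measure; rewrite ?inE//.
  by move=> w /= /lt_le_trans; exact.
have mFh t : measurable_fun setT (fun x : T1 * T2 => Fh t x.1 x.2).
  apply: measurable_funM.
    exact: (measurableT_comp (f := fun k : nat => (k%:R)^-1 : R))
      (measurableT_comp (mm t) measurable_fst).
  under eq_fun do rewrite big_mkcond/=.
  apply: measurable_sum => j.
  under eq_fun do rewrite inE.
  have ma1 : measurable_fun setT (fun x : T1 * T2 => a t x.1).
    exact: measurableT_comp (ma t) measurable_fst.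
  apply: measurable_fun_ifT => //.
    apply: measurable_fun_ler => //.
    exact: measurableT_comp (mb t j) measurable_fst.
  apply: measurable_fun_nat_of_bool; apply: measurable_fun_ltr => //.
  exact: measurableT_comp (mD t j) measurable_snd.
have mpass t : measurable [set x : T1 * T2 | q t < Fh t x.1 x.2 - r t x.1].
  rewrite -[X in measurable X]setTI.
  have mdiff :=
    measurable_funB (mFh t) (measurableT_comp (mr t) measurable_fst).
  exact: (measurable_fun_ltr (measurable_cst (q t)) mdiff measurableT
    (Y := [set true])).
have mcover t : measurable [set x : T1 * T2 | q t < F t (a t x.1)].
  rewrite -[X in measurable X]setTI.
  have mFa1 : measurable_fun setT (fun x : T1 * T2 => F t (a t x.1)).
    exact: (measurableT_comp (mFa t) measurable_fst).
  exact: (measurable_fun_ltr (measurable_cst (q t)) mFa1 measurableT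
    (Y := [set true])).

(* From conditional to frozen probabilities *)
have key (C : set (T1 * T2)) (A H : set Omega) : measurable C ->
    (forall w, A w <-> C (w, w)) ->
    (forall w, H w -> ((1 - delta)%:E <= P (xsection C w))%E) ->
    cond_prob_ge_on P G A (1 - delta) H.
  move=> mC AC HC f fA.
  have AE : A = [set w | C (w, w)] by apply/seteqP; split => w /AC.
  rewrite AE in fA.
  have [M [mM PM sM]] := cond_prob_ge_section GGm Sm SI ST indS mC fA.
  exists M; split => // w /= nH; apply: sM => /= fw.
  by apply: nH => /HC le1; rewrite -lee_fin (le_trans le1).
have m1x (C : set (T1 * T2)) w : measurable C -> d.-measurable (xsection C w).
  move=> mC; have : measurable (xsection C w) by exact: measurable_xsection.
  by apply: smallest_sub => //; exact: sigma_algebra_measurable.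
have mallpass :
    measurable [set x : T1 * T2 | forall t, q t < Fh t x.1 x.2 - r t x.1].
  rewrite (_ : [set _ | _] = \bigcap_(t in [set: 'I_T])
    [set x : T1 * T2 | q t < Fh t x.1 x.2 - r t x.1]).
    by apply: fin_bigcap_measurable.
  by apply/seteqP; split => x xP t; [move=> _; exact: xP|exact: xP].
have mallcover : measurable [set x : T1 * T2 | forall t, q t < F t (a t x.1)].
  rewrite (_ : [set _ | _] = \bigcap_(t in [set: 'I_T])
    [set x : T1 * T2 | q t < F t (a t x.1)]).
    by apply: fin_bigcap_measurable.
  by apply/seteqP; split => x xP t; [move=> _; exact: xP|exact: xP].
have passE w : passes w <-> forall t, q t < Fh t w w - r t w.
  by split => pw t; [rewrite -FhE|rewrite FhE].
have FhK t w w' : (1 <= m t w)%N -> (m t w)%:R * Fh t w w' =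
    \sum_(j in admissible b a t w) (D t j w' < a t w)%R%:R.
  by move=> m1; rewrite mulrA divff ?mul1r// pnatr_eq0 -lt0n.
have mimply : measurable [set x : T1 * T2 |
    (forall t, q t < Fh t x.1 x.2 - r t x.1) -> forall t, q t < F t (a t x.1)].
  rewrite (_ : [set _ | _] = ~` [set x | forall t, q t < Fh t x.1 x.2 - r t x.1]
      `|` [set x | forall t, q t < F t (a t x.1)]).
    by apply: measurableU => //; exact: measurableC.
  by apply/seteqP; split => x /=; rewrite -implyE.

(* The two coverage guarantees *)
split => //.
- apply: (key _ _ _ mimply) => [w|w m1].
    by rewrite /= -(propext (passE w)).
  apply: (probability_ge_of_cover (ltW delta_gt0) (m1x _ w mimply)
    (fun t => mup t w) (fun t => Pup t w (m1 t))) => w' nC.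
  have /not_implyP[/= pw /existsNP[t /negP]] :
      ~ ((forall t, q t < Fh t w w' - r t w) -> forall t, q t < F t (a t w)).
    by move=> c; apply: nC; exact: mem_set.
  (* Passing without coverage gives [Fh > q + r >= F + r], an overshoot in period [t]. *)
  rewrite -leNgt => Fq; exists t => //; rewrite /up /low /=.
  by rewrite -FhK// ler_pM2l ?ltr0n//; have := pw t; lra.
(* The margins may depend on [w], which is frozen here. *)
- apply: (key _ _ _ mallpass passE) => w [m1 [gamma hg]].
  apply: (probability_ge_of_cover (ltW delta_gt0) (m1x _ w mallpass)
    (fun t => mlow t w) (fun t => Plow t w (m1 t))) => w' nC.
  have /existsNP[t /negP] : ~ (forall t, q t < Fh t w w' - r t w).
    by move=> c; apply: nC; exact: mem_set.
  rewrite -leNgt => Fhq; exists t => //; rewrite /up /low /=.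
  have [g0 qF hm] := hg t.
  (* A failed test gives [Fh <= q + r <= F - gamma + r <= F - r], an undershoot in period [t]. *)
  have rg : r t w <= gamma t / 2 by exact: sqrt_div_le_half (m1 t) g0 hm.
  by rewrite -FhK// ler_pM2l ?ltr0n//; lra.
Qed.
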